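(* There are infinitely many Euler-like substitutions for the conic $Q_{abc}=\{(x,y) : y^2=ax^2+bx+c\}$. Each of them is determined by the choice of $x_0$, provided that $ax_0^2+bx_0+c\geq 0$. Then the point $P_0\equiv(x_0,y_0)$ is given by $$P_0=\left(x_0,\ \pm\sqrt{ax_0^2+bx_0+c}\right).$$
   Context: Here $a,b,c$ are real coefficients and $Q_{abc}$ is the curve $y^2=ax^2+bx+c$, associated with integrals $\int R(x,y)\,dx$, where $R$ is a rational function and $y=\sqrt{ax^2+bx+c}$. Fix an arbitrary point $P_0=(x_0,y_0)$ on $Q_{abc}$, assign to any other point $P=(x,y)$ of $Q_{abc}$ the line $P_0P$, and take as a parameter the slope $t$ of this line, so that $y-y_0=t(x-x_0)$. For $x\neq x_0$, the equations $y^2=ax^2+bx+c$ and $y_0^2=ax_0^2+bx_0+c$ then give $t(y+y_0)=a(x+x_0)+b$. Solving this together with $y-y_0=t(x-x_0)$ for $x,y$ (where $t^2\neq a$) expresses $x$ and $y$ as rational functions of $t$: $$x=\frac{x_0t^2-2y_0t+ax_0+b}{t^2-a},\qquad y=\frac{-y_0t^2+(2ax_0+b)t-ay_0}{t^2-a}.$$ An Euler-like substitution is a substitution obtained in this way from a point $P_0\in Q_{abc}$; $P_0$ is the point referred to in the claim.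
   Formalization: The claim of infinitely many substitutions is proved assuming the conic has two distinct real points; without this it fails, e.g. y^2=-x^2-1 has no real points and y^2=-x^2 has only one. *)

(* Defs.v *)
From mathcomp Require Import all_boot all_order all_algebra.
From mathcomp Require Import classical_sets cardinality reals.
From mathcomp Require Import ring.
Set Implicit Arguments.
Unset Strict Implicit.
Unset Printing Implicit Defensive.
Import Order.TTheory GRing.Theory Num.Theory.
Local Open Scope classical_set_scope.
Local Open Scope ring_scope.

Definition radicand (R : realType) (a b c x : R) : R := a * x ^+ 2 + b * x + c.

Definition conic (R : realType) (a b c : R) : set (R * R) :=
  [set P | P.2 ^+ 2 = radicand a b c P.1].

Definition slope (R : realType) (a : R) := {t : R | t ^+ 2 != a}.

(* The coefficient c is absent from the formulas: it enters only through the
   condition that P0 lies on the conic. *)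
Definition euler_subst (R : realType) (a b : R) (P0 : R * R) (t : slope a) :
    R * R :=
  let: (x0, y0) := P0 in
  let s := val t in
  ((x0 * s ^+ 2 - 2 * y0 * s + a * x0 + b) / (s ^+ 2 - a),
   (- y0 * s ^+ 2 + (2 * a * x0 + b) * s - a * y0) / (s ^+ 2 - a)).

(* Substitutions are compared as functions on {t | t^2 <> a}, so two base points
   giving the same rational functions of t count once. *)
Definition euler_like (R : realType) (a b c : R) : set (slope a -> R * R) :=
  [set @euler_subst R a b P0 | P0 in conic a b c].
Arguments euler_subst {R} a b P0 t.
Arguments euler_like {R} a b c _.

Lemma euler_subst_system (R : realType) (a b : R) (x0 y0 x y : R) (t : slope a) :
  euler_subst a b (x0, y0) t = (x, y) <->
  y - y0 = val t * (x - x0) /\ val t * (y + y0) = a * (x + x0) + b.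
Proof.
case: t => s /= hs; have d0 : s ^+ 2 - a != 0 by rewrite subr_eq0.
split=> [[<- <-]|[e1 e2]]; first by split; field.
have ey : y = y0 + s * (x - x0) by rewrite -e1 addrC subrK.
have ex : x * (s ^+ 2 - a) = x0 * s ^+ 2 - 2 * y0 * s + a * x0 + b.
  apply/eqP; rewrite -subr_eq0; apply/eqP.
  have -> : b = s * (y + y0) - a * (x + x0) by rewrite e2 addrAC subrr add0r.
  by rewrite ey; ring.
have -> : x = (x0 * s ^+ 2 - 2 * y0 * s + a * x0 + b) / (s ^+ 2 - a).
  by rewrite -ex mulfK.
rewrite ey -ex mulfK //; congr pair.
apply: (mulIf d0); rewrite divfK //.
have -> : b = x * (s ^+ 2 - a) - (x0 * s ^+ 2 - 2 * y0 * s + a * x0).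
  by rewrite ex; ring.
ring.
Qed.

Lemma euler_subst_conic (R : realType) (a b c : R) (P0 : R * R) (t : slope a) :
  conic a b c P0 -> conic a b c (euler_subst a b P0 t).
Proof.
case: P0 => x0 y0; case e: (euler_subst a b (x0, y0) t) => [x y].
rewrite /conic /radicand /= => h.
have /euler_subst_system[e1 e2] := e.
have : (y - y0) * (y + y0) = (x - x0) * (a * (x + x0) + b).
  by rewrite e1 -e2; ring.
have -> : (y - y0) * (y + y0) = y ^+ 2 - y0 ^+ 2 by ring.
by move/eqP; rewrite subr_eq h => /eqP ->; ring.
Qed.

Lemma euler_subst_slope (R : realType) (a b c : R) (x0 y0 x y : R)
    (t : slope a) :
  conic a b c (x0, y0) -> conic a b c (x, y) -> x != x0 ->
  val t = (y - y0) / (x - x0) -> euler_subst a b (x0, y0) t = (x, y).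
Proof.
rewrite /conic /radicand /= => h0 h nx et; apply/euler_subst_system.
have d0 : x - x0 != 0 by rewrite subr_eq0.
rewrite /= et; split; first by rewrite divfK.
apply: (mulIf d0); rewrite mulrAC divfK //.
have -> : (y - y0) * (y + y0) = y ^+ 2 - y0 ^+ 2 by ring.
by rewrite h h0; ring.
Qed.

(* Main.v *)
Require Import Defs.
From mathcomp Require Import all_boot all_order all_algebra.
From mathcomp Require Import classical_sets cardinality reals.
From mathcomp Require Import ring lra.
Import Order.TTheory GRing.Theory Num.Theory.
Local Open Scope classical_set_scope.
Local Open Scope ring_scope.

(** The map from base points to substitutions is injective: the value at [t] of
    the substitution based at [P0] is a point of the line through [P0] of slope
    [t]; if two base points give the same value at [t], they both lie on one
    line of slope [t] ([euler_subst_same_line]), and this for two different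
    slopes forces them to coincide ([euler_subst_inj]). So there are as many
    Euler-like substitutions as points on the conic, degenerate or not.

    It remains to see that a conic with two distinct points has infinitely many
    ([infinite_conic]). If the radicand is positive somewhere, it stays
    nonnegative at infinitely many abscissas nearby
    ([infinite_conic_radicand_gt0]). Otherwise the two points lie on the axis,
    at two distinct zeros of the radicand, which is then [a] times the product
    of two linear factors, nonnegative either between the zeros or beyond them
    ([infinite_conic_zeros]).

    The description of the base points by their abscissa is the extraction of
    square roots in the equation of the conic ([conicP]). *)

Lemma infinite_set_seq (T : Type) (A : set T) (u : nat -> T) :
  injective u -> (forall n, A (u n)) -> infinite_set A.
Proof.
move=> u_inj uA; apply: (@sub_infinite_set _ [set u n | n in [set: nat]]).
  by move=> _ [n _ <-].
rewrite (eq_finite_set (inj_card_eq _)); first exact: infinite_nat.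
by move=> m n _ _; apply: u_inj.
Qed.

Lemma conicP (R : realType) (a b c x0 y0 : R) :
  conic a b c (x0, y0) <->
  0 <= radicand a b c x0 /\
  ((x0, y0) = (x0, Num.sqrt (radicand a b c x0)) \/
   (x0, y0) = (x0, - Num.sqrt (radicand a b c x0))).
Proof.
rewrite /conic /=; split=> [<-|[r_ge0]].
  split; first exact: sqr_ge0.
  rewrite sqrtr_sqr; case: (ger0P y0) => _; first by left.
  by right; rewrite opprK.
by case=> -[->]; rewrite ?sqrrN sqr_sqrtr.
Qed.

Section EulerSubstInjective.
Variables (R : realType) (a b : R).

Lemma euler_subst_same_line (P P' : R * R) (t : slope a) :
  euler_subst a b P t = euler_subst a b P' t ->
  P'.2 - P.2 = val t * (P'.1 - P.1).
Proof.
case: P P' => [x0 y0] [x1 y1] /= eq_t.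
case e: (euler_subst a b (x0, y0) t) => [x y].
have [e0 _] := (euler_subst_system b x0 y0 x y t).1 e.
have [e1 _] := (euler_subst_system b x1 y1 x y t).1 (etrans (esym eq_t) e).
have -> : y1 - y0 = (y - y0) - (y - y1) by ring.
by rewrite e0 e1 -mulrBr; congr (_ * _); ring.
Qed.

Lemma euler_subst_inj : injective (@euler_subst R a b).
Proof.
move=> P P' eqPP'.
(* Both slopes [s] and [- s] are admissible, since [s ^+ 2 > `|a|]. *)
pose s := 1 + `|a|; have s_gt0 : 0 < s by rewrite ltr_pwDl.
have s2_neq : s ^+ 2 != a.
  rewrite gt_eqF // (le_lt_trans (ler_norm a)) //.
  by rewrite /s; have := normr_ge0 a; nra.
have Ns2_neq : (- s) ^+ 2 != a by rewrite sqrrN.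
have /= e1 := euler_subst_same_line _ _ (exist _ s s2_neq) (congr1 (@^~ _) eqPP').
have /= e2 := euler_subst_same_line _ _ (exist _ (- s) Ns2_neq) (congr1 (@^~ _) eqPP').
have dx : P'.1 - P.1 = 0.
  have /eqP : s * (P'.1 - P.1) = 0 by lra.
  by rewrite mulf_eq0 gt_eqF //= => /eqP.
have dy : P'.2 - P.2 = 0 by rewrite e1 dx mulr0.
by case: P P' {eqPP' e1 e2} dx dy => [x y] [x' y'] /=
  /eqP + /eqP; rewrite !subr_eq0 => /eqP -> /eqP ->.
Qed.

End EulerSubstInjective.

Section InfiniteConic.
Variables (R : realType) (a b c : R).
Implicit Types (x p q : R) (P : R * R).

Lemma infinite_conic_seq (x : nat -> R) :
  injective x -> (forall n, 0 <= radicand a b c (x n)) ->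
  infinite_set (conic a b c).
Proof.
move=> x_inj x_ge0.
apply: (@infinite_set_seq _ _ (fun n => (x n, Num.sqrt (radicand a b c (x n))))).
  by move=> m n [/x_inj].
by move=> n; apply/conicP; split=> //; left.
Qed.

(** Moving from [p] by [h] changes the radicand by
    [(2 * a * p + b) * h + a * h ^+ 2]: in the direction where the linear term
    is nonnegative, a step of length [d <= 1] with [`|a| * d <= r] cannot make
    a radicand of value [r] negative. *)
Lemma infinite_conic_radicand_gt0 p :
  0 < radicand a b c p -> infinite_set (conic a b c).
Proof.
move: (erefl (radicand a b c p)).
move: {2 3}(radicand a b c p) => r rE r_gt0.
pose e : R := if 0 <= 2 * a * p + b then 1 else -1.
have e2 : e ^+ 2 = 1 by rewrite /e; case: ifP => _; ring.
have e_ge0 : 0 <= e * (2 * a * p + b).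
  rewrite /e; case: (lerP 0 (2 * a * p + b)) => [h|/ltW h]; first by rewrite mul1r.
  by rewrite mulN1r oppr_ge0.
(* A strictly decreasing sequence of admissible step lengths. *)
pose d n : R := r / (r + `|a| + n%:R).
have den_gt0 n : 0 < r + `|a| + n%:R.
  by rewrite ltr_wpDr // ltr_wpDr.
have d_gt0 n : 0 < d n by rewrite divr_gt0.
apply: (@infinite_conic_seq (fun n => p + e * d n)) => [m n /addrI emn|n].
  have /(congr1 ( *%R e)) := emn.
  rewrite !mulrA -expr2 e2 !mul1r => /(mulfI (lt0r_neq0 r_gt0)) /invr_inj.
  by move/addrI/eqP; rewrite eqr_nat => /eqP.
have dE : d n * (r + `|a| + n%:R) = r by rewrite divfK // gt_eqF.
have n_ge0 : 0 <= n%:R :> R by [].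
have a_ge0 := normr_ge0 a.
have d_le1 : d n <= 1.
  by rewrite ler_pdivrMr // mul1r -addrA lerDl addr_ge0.
have -> : radicand a b c (p + e * d n) =
    radicand a b c p + (e * (2 * a * p + b)) * d n + a * (e ^+ 2) * d n ^+ 2.
  by rewrite /radicand; ring.
rewrite rE e2 mulr1.
have lin_ge0 := mulr_ge0 e_ge0 (ltW (d_gt0 n)).
have ad_le : `|a| * d n <= r.
  have := mulr_ge0 (ltW (d_gt0 n)) n_ge0.
  have := mulr_ge0 (ltW (d_gt0 n)) (ltW r_gt0).
  by move: dE; nra.
have add_le : `|a| * d n ^+ 2 <= r.
  apply: le_trans ad_le; rewrite expr2 mulrA ler_piMr //.
  by rewrite mulr_ge0 // ltW.
have : - (`|a| * d n ^+ 2) <= a * d n ^+ 2.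
  by rewrite -mulNr ler_wpM2r ?sqr_ge0 // lerNl -normrN ler_norm.
by lra.
Qed.

(** Since [p] and [q] are zeros, the radicand at [p + l * (q - p)] is
    [a * (l * (l - 1)) * (q - p) ^+ 2], so [l] is taken beyond [1] or in
    [0, 1] according to the sign of [a]. *)
Lemma infinite_conic_zeros p q :
  p != q -> radicand a b c p = 0 -> radicand a b c q = 0 ->
  infinite_set (conic a b c).
Proof.
move=> pq rp rq.
have d_neq0 : q - p != 0 by rewrite subr_eq0 eq_sym.
pose l n : R := if 0 <= a then n.+1%:R else n.+1%:R^-1.
apply: (@infinite_conic_seq (fun n => p + l n * (q - p))) => [m n|n].
  move=> /addrI /(mulIf d_neq0); rewrite /l.
  by case: ifP => _ => [|/invr_inj] /eqP; rewrite eqr_nat eqSS => /eqP.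
have -> : radicand a b c (p + l n * (q - p)) =
    (1 - l n) * radicand a b c p + l n * radicand a b c q +
    a * (l n * (l n - 1)) * (q - p) ^+ 2.
  by rewrite /radicand; ring.
rewrite rp rq !mulr0 !add0r mulr_ge0 ?sqr_ge0 // /l.
have n1_gt0 : 0 < n.+1%:R :> R by rewrite ltr0n.
have n1_ge1 : 1 <= n.+1%:R :> R by rewrite ler1n.
case: (lerP 0 a) => [a_ge0|a_lt0].
  by rewrite mulr_ge0 // mulr_ge0 ?subr_ge0 // ltW.
rewrite mulr_le0 ?(ltW a_lt0) // mulr_ge0_le0 ?invr_ge0 ?(ltW n1_gt0) //.
by rewrite subr_le0 invf_le1.
Qed.

Lemma infinite_conic P P' :
  conic a b c P -> conic a b c P' -> P != P' -> infinite_set (conic a b c).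
Proof.
case: P P' => [x y] [x' y']; rewrite {1 2}/conic /= => hP hP' neq.
have [y0|y_neq0] := eqVneq y 0; last first.
  apply: (@infinite_conic_radicand_gt0 x).
  by rewrite -hP lt0r sqrf_eq0 y_neq0 sqr_ge0.
have [y'0|y'_neq0] := eqVneq y' 0; last first.
  apply: (@infinite_conic_radicand_gt0 x').
  by rewrite -hP' lt0r sqrf_eq0 y'_neq0 sqr_ge0.
apply: (@infinite_conic_zeros x x').
- by apply: contraNneq neq => ->; rewrite y0 y'0.
- by rewrite -hP y0 expr0n.
- by rewrite -hP' y'0 expr0n.
Qed.

End InfiniteConic.

Theorem corollary3p1 (R : realType) (a b c : R) :
  ((exists P P' : R * R, [/\ conic a b c P, conic a b c P' & P != P']) ->
     infinite_set (euler_like a b c)) /\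
  (forall phi : slope a -> R * R,
     euler_like a b c phi <->
     exists2 x0 : R, 0 <= radicand a b c x0 &
       phi = euler_subst a b (x0, Num.sqrt (radicand a b c x0)) \/
       phi = euler_subst a b (x0, - Num.sqrt (radicand a b c x0))) /\
  (forall x0 y0 : R,
     conic a b c (x0, y0) <->
     0 <= radicand a b c x0 /\
     ((x0, y0) = (x0, Num.sqrt (radicand a b c x0)) \/
      (x0, y0) = (x0, - Num.sqrt (radicand a b c x0)))).
Proof.
split; [|split].
- move=> [P [P' [hP hP' neq]]]; rewrite /euler_like.
  rewrite (eq_finite_set (inj_card_eq _)).
    exact: infinite_conic hP hP' neq.
  by move=> Q Q' _ _; apply: euler_subst_inj.
- move=> phi; split=> [[[x0 y0] /conicP[r_ge0 y0E] <-]|[x0 r_ge0 phiE]].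
    by exists x0 => //; case: y0E => ->; [left|right].
  case: phiE => ->.
    by exists (x0, Num.sqrt (radicand a b c x0)) => //; apply/conicP; split; [|left].
  by exists (x0, - Num.sqrt (radicand a b c x0)) => //; apply/conicP; split; [|right].
- exact: conicP.
Qed.
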